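(* Assume the following statement holds: for every positive integer $k$ and every probability distribution on $\mathcal P_k$, if $\pi_1,\pi_2$ are sampled independently from this distribution then $\mathbb{E}[\mathrm{LCS}(\pi_1,\pi_2)]\geq\sqrt{k}$. Then for every fixed integer $k\geq 2$, \[ \mathrm{LT}(k,n)/n\geq\tfrac{1}{100}k^{-12/19}\log^{-8/19}k-o(1)\quad\text{as } n\to\infty. \]
   Context: $\mathcal{P}_k$ is the set of permutations on $k$ letters (words over $[k]=\{1,\dots,k\}$ in which each letter occurs exactly once). $\mathrm{LCS}(w,w')$ is the length of a longest common subsequence of words $w,w'$. Two subsequences of a word $w$ are twins if they are equal as words and use disjoint sets of positions of $w$; $\mathrm{LT}(w)$ is the maximum length of twins in $w$ and $\mathrm{LT}(k,n)=\min_{w\in[k]^n}\mathrm{LT}(w)$. $\log$ is the natural logarithm. *)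

(* Defs.v *)
From mathcomp Require Import all_boot all_order all_fingroup all_algebra.
From mathcomp Require Import all_classical all_reals all_analysis.
Set Implicit Arguments. Unset Strict Implicit. Unset Printing Implicit Defensive.
Import Order.TTheory GRing.Theory Num.Theory.

Definition LCS (T : eqType) (w w' : seq T) : nat :=
  \max_(m : (size w).-tuple bool | subseq (mask m w) w') size (mask m w).

Definition twins (T : eqType) (w : seq T) (m1 m2 : (size w).-tuple bool) : bool :=
  [forall i : 'I_(size w), ~~ (tnth m1 i && tnth m2 i)] &&
  (mask m1 w == mask m2 w).

Definition LT (T : eqType) (w : seq T) : nat :=
  \max_(m1 : (size w).-tuple bool)
    \max_(m2 : (size w).-tuple bool | twins m1 m2) size (mask m1 w).

(* LT(k,n) = min over words w in [k]^n of LT(w). (The identity n is harmless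
   since LT(w) <= n.) *)
Definition LTkn (k n : nat) : nat :=
  \big[minn/n]_(w : n.-tuple 'I_k) LT (tval w).

Definition perm_word (k : nat) (s : {perm 'I_k}) : seq 'I_k :=
  [seq s i | i <- enum 'I_k].

Local Open Scope ring_scope.

Definition is_distr (R : realType) (k : nat) (p : {ffun {perm 'I_k} -> R}) : Prop :=
  (forall s, 0 <= p s) /\ \sum_(s : {perm 'I_k}) p s = 1.

Definition expected_LCS (R : realType) (k : nat) (p : {ffun {perm 'I_k} -> R}) : R :=
  \sum_(s : {perm 'I_k}) \sum_(t : {perm 'I_k})
     p s * p t * (LCS (perm_word s) (perm_word t))%:R.

Definition bound_const (R : realType) (k : nat) : R :=
  100^-1 * ((k%:R : R) `^ (- (12%:R / 19%:R))) * ((ln (k%:R : R)) `^ (- (8%:R / 19%:R))).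

(* Main.v *)
Require Import Defs.
From mathcomp Require Import all_boot all_order all_fingroup all_algebra.
From mathcomp Require Import all_classical all_reals all_analysis.
From mathcomp Require Import zify ring lra.
Set Implicit Arguments. Unset Strict Implicit. Unset Printing Implicit Defensive.
Import Order.TTheory GRing.Theory Num.Theory.

(* Cut the word into blocks of length [L], of order [(k^(3/2) * ln k)^(12/19)].

   A block with fewer than [L/4] distinct letters contains more than [L/6] disjoint
   triples of equal letters. Ordering these by first, second and third element gives
   three linear orders, two of which agree on a set of at least [(L/6)^(1/3)] triples;
   this yields twins of that length inside the block.

   If most blocks have at least [L/4] distinct letters, let [q >= L/8] be the number of
   letters that occur in a proportion [L/(8k)] of them. Concatenating about
   [(8k/L) * ln k] random blocks produces almost all of these [q] letters, hence a random
   permutation of them up to few completions. The LCS of two such permutations is at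
   least [sqrt q] on average, and at most the sum of the LCS over all pairs of their blocks;
   so two random blocks have a large LCS on average. Finally, for each shift [d] the common
   subsequences of blocks [i] and [i + d] glue to twins, using half of the values of [i]. *)

(** * Longest common subsequences, and twins as lists of positions *)

Section Twins.
Variables (T : eqType) (x0 : T).
Implicit Types (u v w z : seq T) (p q : seq nat).

Lemma LCS_geq z u v : subseq z u -> subseq z v -> (size z <= LCS u v)%N.
Proof.
move=> /subseqP[m sm ->] zv; rewrite /LCS.
have sm' : size m == size u by rewrite sm.
exact: (leq_bigmax_cond (Tuple sm') zv).
Qed.

Lemma LCS_witness u v : exists z, [/\ subseq z u, subseq z v & size z = LCS u v].
Proof.
have [|m zv Em] := @eq_bigmax_cond _ [pred m : (size u).-tuple bool | subseq (mask m u) v]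
    (fun m => size (mask m u)).
  apply/card_gt0P; exists [tuple of nseq (size u) false].
  by rewrite inE /= mask_false sub0seq.
by exists (mask m u); split=> //; exact: mask_subseq.
Qed.

Lemma LCS_leq u v c :
  (forall z, subseq z u -> subseq z v -> (size z <= c)%N) -> (LCS u v <= c)%N.
Proof. by have [z [zu zv <-]] := LCS_witness u v; apply. Qed.

Lemma LCS_leq_size u v : (LCS u v <= size u)%N.
Proof. by apply: LCS_leq => z /size_subseq. Qed.

Lemma LCSC u v : LCS u v = LCS v u.
Proof. by apply/eqP; rewrite eqn_leq; apply/andP; split; apply: LCS_leq => z zu zv; exact: LCS_geq. Qed.

Lemma LCS_sub u u' v v' : subseq u u' -> subseq v v' -> (LCS u v <= LCS u' v')%N.
Proof.
move=> uu' vv'; apply: LCS_leq => z zu zv.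
by apply: LCS_geq; [exact: subseq_trans uu' | exact: subseq_trans vv'].
Qed.

Lemma subseq_cat_split z u v : subseq z (u ++ v) ->
  exists z1 z2, [/\ z = z1 ++ z2, subseq z1 u & subseq z2 v].
Proof.
move=> /subseqP[m sm ->].
exists (mask (take (size u) m) u), (mask (drop (size u) m) v); split; try exact: mask_subseq.
rewrite -mask_cat ?cat_take_drop // size_take sm size_cat.
by case: ltnP => // h; lia.
Qed.

Lemma LCS_catl u u' v : (LCS (u ++ u') v <= LCS u v + LCS u' v)%N.
Proof.
apply: LCS_leq => z /subseq_cat_split[z1 [z2 [-> zu zu']]] zv; rewrite size_cat.
by apply: leq_add; apply: LCS_geq => //; apply: subseq_trans zv; rewrite ?prefix_subseq ?suffix_subseq.
Qed.

Lemma LCS_flattenl (I : Type) (r : seq I) (f : I -> seq T) v :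
  (LCS (flatten (map f r)) v <= \sum_(i <- r) LCS (f i) v)%N.
Proof.
elim: r => [|i r IH] /=; first by rewrite big_nil LCS_leq_size.
by rewrite big_cons (leq_trans (LCS_catl _ _ _)) // leq_add2l.
Qed.

(** Subadditivity is used in each argument in turn. Summing over all pairs is generous, but only the
    average over random pairs matters later. *)
Lemma LCS_flatten (I J : Type) (r : seq I) (f : I -> seq T) (s : seq J) (g : J -> seq T) :
  (LCS (flatten (map f r)) (flatten (map g s)) <=
     \sum_(i <- r) \sum_(j <- s) LCS (f i) (g j))%N.
Proof.
apply: leq_trans (LCS_flattenl _ _ _) _; apply: leq_sum => i _.
by rewrite LCSC; apply: leq_trans (LCS_flattenl _ _ _) _; apply: leq_sum => j _; rewrite LCSC.
Qed.

(** Twins given by increasing lists of positions instead of boolean masks, so that pieces from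
    different blocks can be translated and concatenated. *)
Definition twin_positions w p q :=
  [/\ sorted ltn p, sorted ltn q, map (nth x0 w) p = map (nth x0 w) q &
      [/\ {in p, forall i, (i < size w)%N}, {in q, forall i, (i < size w)%N}
        & {in p & q, forall i j, i != j}]].

Lemma mask_positions w p : sorted ltn p -> {in p, forall i, (i < size w)%N} ->
  mask (mkseq (mem p) (size w)) w = map (nth x0 w) p.
Proof.
move=> sp pw; rewrite -{2}(mkseq_nth x0 w) /mkseq -map_mask -filter_mask.
congr map; apply: (irr_sorted_eq ltn_trans ltnn) => //.
  by apply: sorted_filter; [exact: ltn_trans | exact: iota_ltn_sorted].
move=> i; rewrite mem_filter mem_iota add0n /=.
by case: (boolP (i \in p)) => //= /pw ->.
Qed.

Lemma LT_geq w p q : twin_positions w p q -> (size p <= LT w)%N.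
Proof.
case=> sp sq epq [pw qw pq]; rewrite /LT.
have st (r : seq nat) : size (mkseq (mem r) (size w)) == size w by rewrite size_mkseq.
have Ep := mask_positions sp pw; have Eq := mask_positions sq qw.
apply: (bigop.bigmax_sup (Tuple (st p))) => //.
apply: (bigop.bigmax_sup (Tuple (st q))); last by rewrite /= Ep size_map.
rewrite /twins /= Ep Eq epq eqxx andbT; apply/forallP => i.
rewrite !(tnth_nth false) /= !nth_mkseq //.
apply/negP => /andP[ip iq]; by have := pq _ _ ip iq; rewrite eqxx.
Qed.

Lemma LT_leq_size w : (LT w <= size w)%N.
Proof.
apply/bigmax_leqP => m1 _; apply/bigmax_leqP => m2 _.
exact: size_subseq (mask_subseq _ _).
Qed.

Lemma subseq_positions z u : subseq z u -> exists p,
  [/\ sorted ltn p, {in p, forall i, (i < size u)%N} & z = map (nth x0 u) p].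
Proof.
case/subseqP => m sm ->; exists (mask m (iota 0 (size u))); split.
- apply: (subseq_sorted ltn_trans (mask_subseq _ _)); exact: iota_ltn_sorted.
- by move=> i /mem_mask; rewrite mem_iota.
- by rewrite map_mask -/(mkseq _ _) mkseq_nth.
Qed.

End Twins.

(** * Gluing pieces of twins found in blocks *)

Section Blocks.
Variables (T : eqType) (x0 : T) (L : nat).
Hypothesis L_gt0 : (0 < L)%N.
Implicit Types (w : seq T) (p q : seq nat).

Definition block w i := take L (drop (i * L) w).

Lemma size_block w i : (i < size w %/ L)%N -> size (block w i) = L.
Proof.
move=> iw; rewrite size_takel // size_drop.
have := leq_trunc_div (size w) L; have : (i.+1 * L <= size w %/ L * L)%N by rewrite leq_mul2r iw orbT.
rewrite mulSn; lia.
Qed.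

Lemma nth_block w i j : (j < L)%N -> nth x0 (block w i) j = nth x0 w (i * L + j).
Proof. by move=> jL; rewrite nth_take // nth_drop. Qed.

(** [phi i] is the number of the block that contains the positions in [f i]; positions in different
    blocks compare as their block numbers do. *)
Lemma sorted_flatten_blocks (I : seq nat) (f : nat -> seq nat) (phi : nat -> nat) :
  sorted ltn I -> {in I &, {homo phi : i j / (i < j)%N}} ->
  {in I, forall i, sorted ltn (f i)} ->
  (forall i j, i \in I -> j \in f i -> j %/ L = phi i)%N ->
  sorted ltn (flatten (map f I)).
Proof.
move=> sI mphi sf fb.
have pI : pairwise ltn I by rewrite -(sorted_pairwise ltn_trans).
rewrite (sorted_pairwise ltn_trans).
elim: I pI mphi sf fb {sI} => [//|i I IH] /= /andP[iI pI] mphi sf fb.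
rewrite pairwise_cat -(sorted_pairwise ltn_trans) sf ?mem_head //=.
rewrite IH ?andbT //; last 3 first.
- by move=> a b aI bI; apply: mphi; rewrite inE ?aI ?bI orbT.
- by move=> a aI; apply: sf; rewrite inE aI orbT.
- by move=> a b aI; apply: fb; rewrite inE aI orbT.
apply/allrelP => a b ai /flattenP[_ /mapP[j jI ->]] bj.
have jI' : j \in i :: I by rewrite inE jI orbT.
have /mphi : (i < j)%N by move/allP: iI; apply.
rewrite mem_head => /(_ isT jI').
rewrite -(fb i a) ?mem_head // -(fb j b) //.
by apply: contraLR; rewrite -!leqNgt; exact: leq_div2r.
Qed.

(** The first twin takes its [i]-th piece from block [phi i], the second from block [psi i]; both
    maps increase, so the pieces concatenate in order. A block can serve both twins only for the
    same [i], and there the pieces are required to be disjoint. The lists [p] and [q] hold positions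
    relative to the blocks. *)
Lemma LT_blocks w (I : seq nat) (phi psi c : nat -> nat) :
  sorted ltn I -> {in I &, forall i j, phi i = psi j -> i = j} ->
  {in I &, {homo phi : i j / (i < j)%N}} -> {in I &, {homo psi : i j / (i < j)%N}} ->
  {in I, forall i, phi i < size w %/ L}%N -> {in I, forall i, psi i < size w %/ L}%N ->
  (forall i, i \in I -> exists p q,
     [/\ sorted ltn p, sorted ltn q,
         {in p, forall a, (a < L)%N}, {in q, forall a, (a < L)%N} &
       [/\ map (nth x0 (block w (phi i))) p = map (nth x0 (block w (psi i))) q,
           (c i <= size p)%N &
           phi i = psi i -> {in p & q, forall a b, a != b}]]) ->
  (\sum_(i <- I) c i <= LT w)%N.
Proof.
move=> sI inj mphi mpsi phiw psiw H.
have /choice[f Hf] : forall i, exists pq : seq nat * seq nat, i \in I ->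
     [/\ sorted ltn pq.1, sorted ltn pq.2,
         {in pq.1, forall a, (a < L)%N}, {in pq.2, forall a, (a < L)%N} &
       [/\ map (nth x0 (block w (phi i))) pq.1 = map (nth x0 (block w (psi i))) pq.2,
           (c i <= size pq.1)%N &
           phi i = psi i -> {in pq.1 & pq.2, forall a b, a != b}]].
  move=> i; case: (boolP (i \in I)) => [iI|_]; last by exists ([::], [::]).
  by have [p [q ?]] := H i iI; exists (p, q).
pose P i := map (addn (phi i * L)) (f i).1; pose Q i := map (addn (psi i * L)) (f i).2.
have divP b a : (a < L)%N -> ((b * L + a) %/ L)%N = b.
  by move=> aL; rewrite divnMDl // divn_small // addn0.
have ltw b a : (b < size w %/ L)%N -> (a < L)%N -> (b * L + a < size w)%N.
  move=> bw aL; have := leq_trunc_div (size w) L.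
  have : (b.+1 * L <= size w %/ L * L)%N by rewrite leq_mul2r bw orbT.
  rewrite mulSn; lia.
have sadd b s : sorted ltn s -> sorted ltn (map (addn b) s).
  by move=> ss; apply: homo_sorted ss => i j ij; rewrite /= ltn_add2l.
apply: (@leq_trans (size (flatten (map P I)))).
  rewrite size_flatten sumnE /shape !big_map big_seq [leqRHS]big_seq.
  by apply: leq_sum => i /Hf[_ _ _ _ [_ ci _]]; rewrite size_map.
apply: (@LT_geq _ x0 w _ (flatten (map Q I))); split.
- apply: (sorted_flatten_blocks sI mphi); first by move=> i /Hf[? _ _ _ _]; exact: sadd.
  by move=> i _ iI /mapP[a ai ->]; rewrite divP //; case: (Hf i iI) => _ _ /(_ _ ai).
- apply: (sorted_flatten_blocks sI mpsi); first by move=> i /Hf[_ ? _ _ _]; exact: sadd.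
  by move=> i _ iI /mapP[a ai ->]; rewrite divP //; case: (Hf i iI) => _ _ _ /(_ _ ai).
- rewrite !map_flatten -!map_comp; congr flatten; apply/eq_in_map => i iI /=.
  have [_ _ pL qL [e _ _]] := Hf i iI.
  rewrite /P /Q -!map_comp; transitivity (map (nth x0 (block w (phi i))) (f i).1).
    by apply/eq_in_map => a /pL aL /=; rewrite nth_block.
  by rewrite e; apply/eq_in_map => a /qL aL /=; rewrite nth_block.
split.
- move=> _ /flattenP[_ /mapP[i iI ->]] /mapP[a ai ->]; apply: ltw; first exact: phiw.
  by case: (Hf i iI) => _ _ /(_ _ ai).
- move=> _ /flattenP[_ /mapP[i iI ->]] /mapP[a ai ->]; apply: ltw; first exact: psiw.
  by case: (Hf i iI) => _ _ _ /(_ _ ai).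
- move=> _ _ /flattenP[_ /mapP[i iI ->]] /mapP[a ai ->] /flattenP[_ /mapP[j jI ->]] /mapP[b bj ->].
  have [_ _ /(_ _ ai) aL _ [_ _ d]] := Hf i iI; have [_ _ _ /(_ _ bj) bL _] := Hf j jI.
  (* Equal positions lie in one block, so [phi i = psi j] and hence [i = j], against disjointness
     inside that block. *)
  apply/eqP => e.
  have ep : phi i = psi j by rewrite -(divP (phi i) a) // e divP.
  have ij := inj _ _ iI jI ep; subst j.
  by move: (d ep a b ai bj) => /eqP; apply; move: e; rewrite -ep => /addnI.
Qed.

End Blocks.

(** * Blocks with few distinct letters *)

Section Chains.
Variables (T : finType) (e : rel T).

Definition chain (S : {set T}) : bool :=
  [forall a in S, forall b in S, [|| a == b, e a b | e b a]].

Definition chain_below (i : T) (S : {set T}) : bool :=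
  [&& chain S, i \in S & [forall a in S, (a == i) || e a i]].

(** The rank from Mirsky's theorem: the largest size of a chain with top element [i]. *)
Definition height (i : T) : nat := \max_(S | chain_below i S) #|S|.

Hypothesis e_irr : irreflexive e.
Hypothesis e_trans : transitive e.

Lemma chain_below1 i : chain_below i [set i].
Proof.
apply/and3P; split; last 1 first.
- by apply/'forall_implyP => a /set1P->; rewrite eqxx.
- by apply/'forall_implyP => a /set1P->; apply/'forall_implyP => b /set1P->; rewrite eqxx.
- exact: set11.
Qed.

Lemma height_gt0 i : (0 < height i)%N.
Proof.
by apply: leq_trans (leq_bigmax_cond _ (chain_below1 i)); rewrite cards1.
Qed.

Lemma height_witness i : exists2 S, chain_below i S & #|S| = height i.
Proof.
have [|S cS E] := @eq_bigmax_cond _ (chain_below i) (fun S => #|S|).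
  by apply/card_gt0P; exists [set i]; exact: chain_below1.
by exists S.
Qed.

(** A largest chain with top [i] can be extended by [j]. *)
Lemma height_lt i j : e i j -> (height i < height j)%N.
Proof.
move=> eij; have [S /and3P[cS iS /'forall_implyP tS] <-] := height_witness i.
have Sj a : a \in S -> e a j.
  by move=> /tS/orP[/eqP->//|/e_trans]; apply.
have jS : j \notin S by apply/negP => /Sj; rewrite e_irr.
have cardE : #|j |: S| = #|S|.+1 by rewrite cardsU1 jS.
rewrite -cardE; apply: leq_bigmax_cond; apply/and3P; split.
- apply/'forall_implyP => a /setU1P[->|aS]; apply/'forall_implyP => b /setU1P[->|bS].
  + by rewrite eqxx.
  + by rewrite Sj ?orbT.
  + by rewrite Sj ?orbT.
  + by move/'forall_implyP: cS => /(_ a aS)/'forall_implyP/(_ b bS).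
- exact: setU11.
- by apply/'forall_implyP => a /setU1P[->|/Sj->]; rewrite ?eqxx ?orbT.
Qed.

End Chains.

Section ThreeOrders.
Variable T : finType.

Definition both_lt (x y : T -> nat) : rel T := fun i j => (x i < x j)%N && (y i < y j)%N.

Lemma both_lt_irr x y : irreflexive (both_lt x y).
Proof. by move=> i; rewrite /both_lt ltnn. Qed.

Lemma both_lt_trans x y : transitive (both_lt x y).
Proof.
by move=> j i l /andP[a b] /andP[c d]; rewrite /both_lt (ltn_trans a c) (ltn_trans b d).
Qed.

(* Of three linear orders two agree on any given pair, so the triple of heights is injective. *)
Lemma three_orders (x y z : T -> nat) :
  injective x -> injective y -> injective z ->
  exists S : {set T}, (#|T| <= #|S| ^ 3)%N /\
    [\/ chain (both_lt x y) S, chain (both_lt x z) S | chain (both_lt y z) S].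
Proof.
move=> ix iy iz.
have [T0|] := posnP #|T|.
  exists finset.set0; rewrite T0; split=> //; constructor 1.
  by apply/'forall_implyP => a; rewrite inE.
move=> /card_gt0P[i0 _].
(* [S] will be a largest set that is a chain for one of the three pairs of orders; its size bounds
   every height. *)
pose P S := [|| chain (both_lt x y) S, chain (both_lt x z) S | chain (both_lt y z) S].
have [|S PS mS] := @eq_bigmax_cond _ P (fun S => #|S|).
  apply/card_gt0P; exists finset.set0; apply/or3P; constructor 1.
  by apply/'forall_implyP => a; rewrite inE.
exists S; split; last by apply/or3P.
set t := #|S| in mS *.
have ht u v i : (forall S', chain (both_lt u v) S' -> P S') -> (height (both_lt u v) i <= t)%N.
  move=> uP; have [S' /and3P[cS _ _] <-] := height_witness (both_lt u v) i.
  by rewrite -mS; apply: leq_bigmax_cond; exact: uP.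
have hxy i : (height (both_lt x y) i <= t)%N by apply: ht => S' c; rewrite /P c.
have hxz i : (height (both_lt x z) i <= t)%N by apply: ht => S' c; rewrite /P c orbT.
have hyz i : (height (both_lt y z) i <= t)%N by apply: ht => S' c; rewrite /P c !orbT.
have t0 : (0 < t)%N by apply: leq_trans (hxy i0); exact: height_gt0.
case: t t0 hxy hxz hyz {mS ht} => // t _ hxy hxz hyz.
(* Heights lie between 1 and [t.+1], so their predecessors fit in ['I_t.+1]. *)
pose lab i : 'I_t.+1 * 'I_t.+1 * 'I_t.+1 :=
  (inord (height (both_lt x y) i).-1, inord (height (both_lt x z) i).-1,
   inord (height (both_lt y z) i).-1).
suff /leq_card : injective lab by rewrite !card_prod card_ord !expnS expn0 muln1 mulnA.
have inordE u v i j : (forall l, height (both_lt u v) l <= t.+1)%N ->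
   inord (height (both_lt u v) i).-1 = inord (height (both_lt u v) j).-1 :> 'I_t.+1 ->
   both_lt u v i j = false.
  move=> h /(congr1 val); have hi := height_gt0 (both_lt u v) i; have hj := height_gt0 (both_lt u v) j.
  rewrite /= !inordK; [|have := h j; lia|have := h i; lia].
  move=> E; apply/negP => /(height_lt (@both_lt_irr u v) (@both_lt_trans u v)); lia.
have fwd i j : lab i = lab j -> [&& ~~ both_lt x y i j, ~~ both_lt x z i j & ~~ both_lt y z i j].
  by case=> h1 h2 h3; rewrite (inordE _ _ _ _ hxy h1) (inordE _ _ _ _ hxz h2) (inordE _ _ _ _ hyz h3).
move=> i j E; have := fwd _ _ E; have := fwd _ _ (esym E); rewrite /both_lt => h1 h2.
apply/eqP/negPn/negP => ij.
have : x i <> x j by move/ix/eqP; apply/negP.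
have : y i <> y j by move/iy/eqP; apply/negP.
have : z i <> z j by move/iz/eqP; apply/negP.
move: h1 h2; lia.
Qed.

(** Sort [S] by [x]; since any two elements compare the same way in both orders, [y] increases along
    the same list. *)
Lemma chain_sorted (x y : T -> nat) (S : {set T}) : injective x -> chain (both_lt x y) S ->
  exists s : seq T, [/\ size s = #|S|, sorted ltn (map x s) & sorted ltn (map y s)].
Proof.
move=> ix cS; pose s := sort (fun a b => (x a <= x b)%N) (enum S).
have sS : {subset s <= S} by move=> a; rewrite mem_sort mem_enum.
have sx : sorted ltn (map x s).
  rewrite ltn_sorted_uniq_leq map_inj_uniq // sort_uniq enum_uniq /= sorted_map.
  by apply: sort_sorted => a b; exact: leq_total.
exists s; split=> //; first by rewrite size_sort -cardE.
move: sx; rewrite !sorted_map; apply: (@sub_in_sorted _ (mem S)); last by apply/allP.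
move=> a b aS bS /= ab.
move/'forall_implyP: cS => /(_ a aS)/'forall_implyP/(_ b bS); rewrite /both_lt.
case/or3P => [/eqP E|/andP[]//|/andP[]]; first by move: ab; rewrite E ltnn.
by move: ab; lia.
Qed.

End ThreeOrders.

Section Poor.
Variables (K : finType) (x0 : K) (u : seq K).

Let occ a := [seq i <- iota 0 (size u) | nth x0 u i == a].

Let size_occ a : size (occ a) = count_mem a u.
Proof. by rewrite size_filter -[in RHS](mkseq_nth x0 u) count_map. Qed.

Let occE a i : (i < count_mem a u)%N ->
  (nth 0 (occ a) i < size u)%N /\ nth x0 u (nth 0%N (occ a) i) = a.
Proof.
rewrite -size_occ => /(mem_nth 0%N); rewrite mem_filter mem_iota add0n => /andP[/eqP ? /andP[_ ?]].
by split.
Qed.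

Let occ_inj a b i j : (i < count_mem a u)%N -> (j < count_mem b u)%N ->
  nth 0%N (occ a) i = nth 0%N (occ b) j -> a = b /\ i = j.
Proof.
move=> ia jb E; have [_ ea] := occE ia; have [_ eb] := occE jb.
have ab : a = b by rewrite -ea -eb E.
subst b; split=> //; move/eqP: E; rewrite nth_uniq ?size_occ //; first by move/eqP.
by rewrite filter_uniq // iota_uniq.
Qed.

(* The [j]-th disjoint triple of occurrences of [a] consists of the occurrences
   number [3j], [3j+1] and [3j+2]. *)
Let triple := {aj : K * 'I_(size u) | (3 * aj.2 + 2 < count_mem aj.1 u)%N}.

(** A letter with [c] occurrences yields [c %/ 3] triples and leaves at most two positions over, and
    none if it does not occur. *)
Let card_triple : (size u <= 3 * #|{: triple}| + 2 * size (undup u))%N.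
Proof.
rewrite [leqLHS](_ : _ = \sum_(a : K) count_mem a u)%N; last first.
  rewrite -sum1_size (partition_big id predT) //=; apply: eq_bigr => a _.
  by rewrite sum1_count.
have -> : size (undup u) = (\sum_(a : K) (a \in u))%N.
  rewrite -(card_uniqP (undup_uniq u)) -sum1_card big_mkcond /=; apply: eq_bigr => a _.
  by rewrite mem_undup; case: (a \in u).
rewrite card_sig -sum1_card (eq_bigl (fun aj : K * 'I_(size u) => xpredT aj.1 && (3 * aj.2 + 2 < count_mem aj.1 u)%N)) //.
rewrite -(pair_big_dep xpredT (fun a (j : 'I_(size u)) => (3 * j + 2 < count_mem a u)%N) (fun _ _ => 1%N)) /=.
rewrite !big_distrr -big_split /=; apply: leq_sum => a _.
have cu : (count_mem a u <= size u)%N by exact: count_size.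
have -> : (\sum_(j < size u | 3 * j + 2 < count_mem a u) 1 = count_mem a u %/ 3)%N.
  rewrite (big_ord_widen_cond _ (fun j => 3 * j + 2 < count_mem a u)%N (fun=> 1%N) (leqnn _)).
  rewrite (eq_bigl (fun j : 'I_(size u) => (j < count_mem a u %/ 3)%N)).
    rewrite -(big_ord_widen _ (fun=> 1%N)) ?sum1_card ?card_ord //.
    by apply: leq_trans (leq_div _ _) _.
  by move=> j; apply/idP/idP; lia.
have := divn_eq (count_mem a u) 3; have := ltn_pmod (count_mem a u) (isT : (0 < 3)%N).
rewrite -has_pred1 has_count; move: (count_mem a u) => c; clear; case: c => [|c] /=; lia.
Qed.

(** With so few distinct letters there are at least [size u / 6] triples. Two of the orders by
    first, second and third element agree on a large set of triples; reading off these two elements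
    gives increasing lists with equal letters, disjoint because the triples are. *)
Lemma poor_twins : (4 * size (undup u) < size u)%N -> exists p q,
  twin_positions x0 u p q /\ (size u <= 6 * size p ^ 3)%N.
Proof.
move=> poor; pose pos r (t : triple) := nth 0%N (occ (val t).1) (3 * (val t).2 + r).
have ltc r (t : triple) : (r < 3)%N -> (3 * (val t).2 + r < count_mem (val t).1 u)%N.
  by case: t => [[a j] /= h] r3; lia.
have posE r r' (t t' : triple) : (r < 3)%N -> (r' < 3)%N -> pos r t = pos r' t' -> t = t' /\ r = r'.
  move=> r3 r3' /(occ_inj (ltc _ _ r3) (ltc _ _ r3')).
  case: t => [[a j] /= h]; case: t' => [[a' j'] /= h'] /= [E E'].
  have jj : val j = val j' by rewrite /=; lia.
  by split; last lia; apply: val_inj => /=; congr pair => //; exact: val_inj.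
have inj r : (r < 3)%N -> injective (pos r).
  by move=> r3 t t' /posE[].
have [S [cT cS]] := three_orders (inj 0 isT) (inj 1 isT) (inj 2 isT).
have [r [r' [r3 r3' rr' c]]] : exists r r', [/\ (r < 3)%N, (r' < 3)%N, r != r' & chain (both_lt (pos r) (pos r')) S].
  by case: cS => c; [exists 0, 1 | exists 0, 2 | exists 1, 2].
have [s [sS s1 s2]] := chain_sorted (inj r r3) c.
exists (map (pos r) s), (map (pos r') s); split; last first.
  rewrite size_map sS; apply: leq_trans (leq_mul (leqnn 6) cT).
  by move: card_triple poor; move: #|_| => N; clear; lia.
split=> //.
  rewrite -!map_comp; apply: eq_map => t /=.
  by rewrite (occE (ltc r t r3)).2 (occE (ltc r' t r3')).2.
split.
- by move=> _ /mapP[t _ ->]; exact: (occE (ltc r t r3)).1.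
- by move=> _ /mapP[t _ ->]; exact: (occE (ltc r' t r3')).1.
- move=> _ _ /mapP[t _ ->] /mapP[t' _ ->]; apply/eqP => /posE[//|//|_ E].
  by rewrite E eqxx in rr'.
Qed.

End Poor.

(** * Random concatenations of blocks *)

Lemma perm_word_surj (q : nat) (l : seq 'I_q) :
  uniq l -> size l = q -> exists s : {perm 'I_q}, perm_word s = l.
Proof.
move=> ul /eqP sl; have inj : injective (tnth (Tuple sl)).
  exact/tuple_uniqP.
exists (perm inj); rewrite /perm_word.
by rewrite (eq_map (permE inj)) map_tnth_enum.
Qed.

(** One coordinate of a uniform function is uniform. The summand is written as a product whose
    factors are 1 away from [a], and the sum is then distributed. *)
Lemma sum_ffun_eval (s M : nat) (a : 'I_s) (G : 'I_M -> nat) :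
  (\sum_(f : {ffun 'I_s -> 'I_M}) G (f a) = M ^ s.-1 * \sum_i G i)%N.
Proof.
pose F (b : 'I_s) i := (if b == a then G i else 1)%N.
transitivity (\sum_(f : {ffun 'I_s -> 'I_M}) \prod_b F b (f b))%N.
  apply: eq_bigr => f _; rewrite (bigD1 a) //= /F eqxx big1 ?muln1 // => b.
  by move/negPf->.
rewrite -bigA_distr_bigA (bigD1 a) //= /F eqxx mulnC; congr muln.
rewrite (eq_bigr (fun=> M)); first by rewrite prod_nat_const cardC1 card_ord.
by move=> b /negPf->; rewrite sum_nat_const card_ord muln1.
Qed.

Section Sampling.
Variables (q s M : nat) (v : 'I_M -> seq 'I_q).

(** The function [f] lists [s] block indices; a uniform [f] means independent draws with
    replacement. *)
Definition sample_word (f : {ffun 'I_s -> 'I_M}) : seq 'I_q :=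
  flatten [seq v (f a) | a <- enum 'I_s].

Definition missing (f : {ffun 'I_s -> 'I_M}) : seq 'I_q :=
  [seq a <- enum 'I_q | a \notin sample_word f].

Lemma sample_perm f : exists t : {perm 'I_q},
  perm_word t = undup (sample_word f) ++ missing f.
Proof.
apply: perm_word_surj.
  rewrite cat_uniq undup_uniq filter_uniq ?enum_uniq // andbT.
  by apply/hasPn => a; rewrite mem_filter mem_undup => /andP[].
rewrite -[RHS]card_ord cardE; apply/perm_size/uniq_perm; last first.
- by move=> a; rewrite mem_cat mem_undup mem_filter !mem_enum andbT orbN.
- exact: enum_uniq.
rewrite cat_uniq undup_uniq filter_uniq ?enum_uniq // andbT.
by apply/hasPn => a; rewrite mem_filter mem_undup => /andP[].
Qed.

(** Each appended tail of missing letters costs at most its length; the rest is a subsequence of a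
    concatenation of blocks. *)
Lemma LCS_sample f g :
  (LCS (undup (sample_word f) ++ missing f) (undup (sample_word g) ++ missing g) <=
   \sum_a \sum_b LCS (v (f a)) (v (g b)) + size (missing f) + size (missing g))%N.
Proof.
apply: leq_trans (LCS_catl _ _ _) _; rewrite addnAC; apply: leq_add; last exact: LCS_leq_size.
rewrite LCSC; apply: leq_trans (LCS_catl _ _ _) _; apply: leq_add; last exact: LCS_leq_size.
apply: leq_trans (LCS_sub (undup_subseq _) (undup_subseq _)) _.
rewrite LCSC; apply: leq_trans (LCS_flatten _ _ _ _) _.
by rewrite !enumT.
Qed.

(** The letter [a] is missing exactly when all [s] draws avoid it, and the draws are independent. *)
Lemma sum_missing : (\sum_f size (missing f) = \sum_(a : 'I_q) #|[set i | a \notin v i]| ^ s)%N.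
Proof.
transitivity (\sum_(f : {ffun 'I_s -> 'I_M}) \sum_(a : 'I_q) \prod_(b < s) (a \notin v (f b)))%N.
  apply: eq_bigr => f _; rewrite size_filter -sum1_count big_mkcond enumT /=.
  apply: eq_bigr => a _; case: ifPn => [aw|].
    rewrite big1 // => b _; case: (boolP (a \in v (f b))) => // ab; case/negP: aw.
    by apply/flattenP; exists (v (f b)) => //; apply: map_f; rewrite mem_enum.
  rewrite negbK => /flattenP[_ /mapP[b _ ->] ab].
  by rewrite (bigD1 b) //= ab mul0n.
rewrite exchange_big /=; apply: eq_bigr => a _.
rewrite -(bigA_distr_bigA (fun (b : 'I_s) i => (a \notin v i : nat))) /=.
rewrite prod_nat_const card_ord; congr expn.
by rewrite -sum1_card [RHS]big_mkcond; apply: eq_bigr => i _; rewrite inE; case: (a \notin _).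
Qed.

End Sampling.

(** * Upper bound on the LCS summed over all pairs of blocks *)

Lemma sum_pairs_le (F : nat -> nat -> nat) (m L B : nat) :
  (forall i j, F i j = F j i) -> (forall i, (F i i <= L)%N) ->
  (forall d, (0 < d)%N -> (\sum_(j < m | d <= j) F (j - d) j <= B)%N) ->
  (\sum_(i < m) \sum_(j < m) F i j <= m * L + 2 * (m * B))%N.
Proof.
move=> Fsym FL FB; pose G := (\sum_(j < m) \sum_(i < m | i < j) F i j)%N.
have GB : (G <= m * B)%N.
  (* Group the pairs [i < j] by difference: [i] becomes [j - d.+1], with [d.+1] to keep the shift
     positive. *)
  have -> : G = (\sum_(j < m) \sum_(d < m | d < j) F (j - d.+1) j)%N.
    apply: eq_bigr => j _.
    rewrite -(big_ord_widen _ (fun i => F i j)) ?(ltnW (ltn_ord _)) //.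
    rewrite -(big_ord_widen _ (fun d => F (j - d.+1) j)%N) ?(ltnW (ltn_ord _)) //.
    by rewrite (reindex_inj rev_ord_inj).
  rewrite (exchange_big_dep xpredT) //= -[m in (_ <= m * _)%N]card_ord -sum_nat_const.
  by apply: leq_sum => d _; exact: FB.
have -> : (\sum_(i < m) \sum_(j < m) F i j = \sum_(i < m) F i i + (G + G))%N.
  have GE : G = (\sum_(j < m) \sum_(i < m | j < i) F j i)%N.
    by rewrite /G (exchange_big_dep xpredT).
  rewrite {1}GE /G -!big_split /=; apply: eq_bigr => i _.
  rewrite (bigD1 i) //=; congr addn.
  rewrite (bigID (fun j : 'I_m => (i < j)%N)) /=; congr addn.
    by apply: eq_bigl => j; rewrite -val_eqE /=; lia.
  rewrite (eq_bigl (fun j : 'I_m => (j < i)%N)).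
    by apply: eq_bigr => j _; exact: Fsym.
  by move=> j; rewrite -val_eqE /=; lia.
rewrite leq_add //; last lia.
rewrite -[m in (_ <= m * _)%N]card_ord -sum_nat_const; exact: leq_sum.
Qed.

Section WordBlocks.
Variables (T : eqType) (x0 : T) (L : nat) (w : seq T).
Hypothesis L_gt0 : (0 < L)%N.

(* [odd (j %/ d)] tells the blocks feeding the first twin from those feeding the second. *)
Lemma LT_shift (r : seq nat) (d : nat) : sorted ltn r ->
  {in r, forall i, (i < size w %/ L)%N} -> (0 < d)%N ->
  (\sum_(j < size r | d <= j)
     LCS (block L w (nth 0 r (j - d))) (block L w (nth 0 r j)) <= 2 * LT w)%N.
Proof.
move=> sr rw d0; pose c j := LCS (block L w (nth 0 r (j - d))) (block L w (nth 0 r j)).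
have half b : (\sum_(j < size r | (d <= j) && (odd (j %/ d) == b)) c j <= LT w)%N.
  rewrite -(big_mkord (fun j => (d <= j) && (odd (j %/ d) == b))%N c) -big_filter.
  set I := [seq _ <- _ | _].
  have IP j : j \in I -> [/\ (j < size r)%N, (d <= j)%N & odd (j %/ d) = b].
    by rewrite mem_filter mem_index_iota => /andP[/andP[-> /eqP ->]] /=.
  have nthr i j : (i < size r)%N -> (j < size r)%N -> (i < j)%N -> (nth 0 r i < nth 0 r j)%N.
    exact: (sorted_ltn_nth ltn_trans 0 sr).
  apply: (@LT_blocks _ x0 L L_gt0 w I (fun j => nth 0 r (j - d)) (nth 0 r) c).
  - by apply: sorted_filter; [exact: ltn_trans | exact: iota_ltn_sorted].
  - move=> i j /IP[ir di oi] /IP[jr dj oj] /eqP; rewrite nth_uniq ?(leq_ltn_trans (leq_subr _ _)) //; last first.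
      exact: sorted_uniq ltn_trans ltnn _ sr.
    (* If [i - d = j], then [i %/ d] exceeds [j %/ d] by one, so the parities differ. *)
    move=> /eqP E; move: oi oj; rewrite -E -{1}(subnK di) divnDr // divnn d0 addn1 /= => <-.
    by case: (odd _).
  - by move=> i j /IP[ir di _] /IP[jr dj _] ij; apply: nthr; lia.
  - by move=> i j /IP[ir di _] /IP[jr dj _] ij; apply: nthr; lia.
  - by move=> i /IP[ir di _]; apply: rw; apply: mem_nth; exact: leq_ltn_trans (leq_subr _ _) ir.
  - by move=> i /IP[ir di _]; apply: rw; apply: mem_nth.
  - move=> j /IP[jr dj _].
    have [z [z1 z2 zE]] := LCS_witness (block L w (nth 0 r (j - d))) (block L w (nth 0 r j)).
    have [p [sp pL pE]] := subseq_positions x0 z1; have [q [sq qL qE]] := subseq_positions x0 z2.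
    have sb i : (i < size r)%N -> size (block L w (nth 0 r i)) = L.
      by move=> ir; apply: size_block => //; apply: rw; exact: mem_nth.
    exists p, q; split=> //.
    + by move=> a /pL; rewrite sb //; lia.
    + by move=> a /qL; rewrite sb.
    + split; [by rewrite -pE qE | by rewrite /c -zE pE size_map |].
      by move=> E; have := nthr (j - d)%N j; rewrite E ltnn; lia.
rewrite (bigID (fun j : 'I_(size r) => odd (j %/ d) == true)) mul2n -addnn leq_add ?half //=.
by apply: leq_trans (half false); rewrite (eq_bigl (fun j : 'I_(size r) => (d <= j) && (odd (j %/ d) == false))%N) // => j; case: (odd _).
Qed.

(** The diagonal costs at most [L] per block. The factor 4 is 2 for the two orders of a pair times 2
    for the two parity classes of a shift. *)
Lemma sum_LCS_le (r : seq nat) : sorted ltn r ->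
  {in r, forall i, (i < size w %/ L)%N} ->
  (\sum_(i < size r) \sum_(j < size r) LCS (block L w (nth 0 r i)) (block L w (nth 0 r j)) <=
    size r * (L + 4 * LT w))%N.
Proof.
move=> sr rw; apply: leq_trans (sum_pairs_le (F := fun i j => LCS (block L w (nth 0 r i)) (block L w (nth 0 r j)))
   (L := L) (B := 2 * LT w) _ _ _) _.
- by move=> i j; exact: LCSC.
- by move=> i; apply: leq_trans (LCS_leq_size _ _) _; rewrite size_take; case: ltnP => //.
- by move=> d; exact: LT_shift.
- by rewrite mulnDr leq_add2l; lia.
Qed.
End WordBlocks.

Lemma LCS_map (T1 T2 : eqType) (f : T1 -> T2) u v : (LCS u v <= LCS (map f u) (map f v))%N.
Proof.
by apply: LCS_leq => z zu zv; rewrite -(size_map f); apply: LCS_geq; exact: map_subseq.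
Qed.

(** * Twins collected from the poor blocks *)

Definition poor (T : eqType) (L : nat) (w : seq T) (i : nat) : bool :=
  (4 * size (undup (block L w i)) < L)%N.

(** Gluing with [phi] and [psi] both the identity: each poor block contributes twins of length at
    least [c] within itself. *)
Lemma LT_poor (K : finType) (x0 : K) (L c : nat) (w : seq K) : (0 < L)%N ->
  (forall t, (L <= 6 * t ^ 3)%N -> (c <= t)%N) ->
  (count (poor L w) (iota 0 (size w %/ L)) * c <= LT w)%N.
Proof.
move=> L0 cP; rewrite -size_filter; set I := [seq _ <- _ | _].
have -> : (size I * c = \sum_(i <- I) c)%N by rewrite big_const_seq count_predT iter_addn_0 mulnC.
have IP i : i \in I -> (i < size w %/ L)%N /\ poor L w i.
  by rewrite mem_filter mem_iota add0n => /andP[pi /andP[_ iw]].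
apply: (@LT_blocks _ x0 L L0 w I id id (fun=> c)) => //.
- by apply: sorted_filter; [exact: ltn_trans | exact: iota_ltn_sorted].
- by move=> i /IP[].
- by move=> i /IP[].
- move=> i /IP[iw pi]; have sb := size_block L0 iw.
  have /(poor_twins x0)[p [q]] : (4 * size (undup (block L w i)) < size (block L w i))%N by rewrite sb.
  rewrite sb => -[[sp sq E [pL qL d]] /cP cp]; exists p, q; split=> //.
  + by move=> a /pL; rewrite sb.
  + by move=> a /qL; rewrite sb.
Qed.

(** * Lower bound on the average LCS of two blocks *)

Local Open Scope ring_scope.

(** Change of variables: the fibre sizes of [h] are the unnormalized law of [h i] for uniform
    [i]. *)
Lemma sum_pushforward (R : realType) (I J : finType) (h : I -> J) (F : J -> R) :
  \sum_j (\sum_i (h i == j)%:R) * F j = \sum_i F (h i).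
Proof.
under eq_bigr => j _ do rewrite big_distrl /=.
rewrite exchange_big /=; apply: eq_bigr => i _.
rewrite (bigD1 (h i)) //= eqxx mul1r big1 ?addr0 // => j.
by rewrite eq_sym => /negPf->; rewrite mul0r.
Qed.

(** Two independent completed samples have expected LCS at least [sqrt q]. It is also at most
    [s ^+ 2] times the average LCS of two blocks, plus twice the expected number of missing letters.
    A letter is missing with probability at most [(1 - theta) ^+ s], so the latter term is at most
    [sqrt q / 2]. *)
Lemma sum_LCS_ge (R : realType) (q s M : nat) (v : 'I_M -> seq 'I_q) (theta : R) :
  (forall p : {ffun {perm 'I_q} -> R}, is_distr p -> Num.sqrt (q%:R : R) <= expected_LCS p) ->
  (0 < s)%N -> (0 < M)%N -> 
  (forall a, theta * M%:R <= #|[set i | a \in v i]|%:R) ->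
  Num.sqrt (q%:R : R) * (1 - theta) ^+ s <= 4^-1 ->
  Num.sqrt (q%:R : R) / 2 * M%:R ^+ 2 <= s%:R ^+ 2 * \sum_i \sum_j (LCS (v i) (v j))%:R.
Proof.
move=> hyp s0 M0 freq small.
have /choice[Pi PiE] := sample_perm v (s := s).
set N : R := (M ^ s)%:R.
have N0 : 0 < N by rewrite ltr0n expn_gt0 M0.
have cardF : #|{: {ffun 'I_s -> 'I_M}}|%:R = N by rewrite card_ffun !card_ord.
pose p := [ffun t => (\sum_f (Pi f == t)%:R) / N].
have /hyp : is_distr p.
  split=> [t|]; first by rewrite ffunE; apply: divr_ge0; [apply: sumr_ge0 => ? _; exact: ler0n | exact: ltW].
  under eq_bigr => t _ do rewrite ffunE.
  rewrite -mulr_suml (eq_bigr (fun t => (\sum_f (Pi f == t)%:R) * 1)); last by move=> *; rewrite mulr1.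
  rewrite (sum_pushforward Pi (fun=> 1)) sumr_const -[_ *+ _]/(_%:R) cardF divff //.
  by rewrite gt_eqF.
have -> : expected_LCS p = (\sum_f \sum_g (LCS (perm_word (Pi f)) (perm_word (Pi g)))%:R) / N ^+ 2.
  rewrite /expected_LCS.
  transitivity (\sum_t (\sum_f (Pi f == t)%:R) * ((\sum_g (LCS (perm_word t) (perm_word (Pi g)))%:R) / N ^+ 2)).
    apply: eq_bigr => t _; rewrite -(sum_pushforward Pi (fun t' => (LCS (perm_word t) (perm_word t'))%:R)).
    rewrite [X in _ = _ * X]mulr_suml [RHS]mulr_sumr; apply: eq_bigr => t' _; rewrite !ffunE; field.
    by rewrite gt_eqF.
  by rewrite (sum_pushforward Pi (fun t => (\sum_g (LCS (perm_word t) (perm_word (Pi g)))%:R) / N ^+ 2)) mulr_suml.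
rewrite ler_pdivlMr ?exprn_gt0 // => lower.
set S := \sum_i \sum_j _; set Q := Num.sqrt (q%:R : R) in small lower *.
have Q0 : 0 <= Q by exact: sqrtr_ge0.
have QQ : Q * Q = q%:R by rewrite -expr2 sqr_sqrtr.
pose m : R := \sum_(f : {ffun 'I_s -> 'I_M}) (size (missing v f))%:R.
have upper : \sum_f \sum_g (LCS (perm_word (Pi f)) (perm_word (Pi g)))%:R <=
    s%:R ^+ 2 * ((M ^ s.-1)%:R ^+ 2 * S) + 2 * N * m.
  have -> : 2 * N * m = \sum_(f : {ffun 'I_s -> 'I_M}) \sum_(g : {ffun 'I_s -> 'I_M}) ((size (missing v f))%:R + (size (missing v g))%:R).
    under [RHS]eq_bigr => f _ do rewrite big_split /= sumr_const -[_ *+ #|_|]mulr_natl cardF.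
    by rewrite big_split /= -mulr_sumr sumr_const -[_ *+ #|_|]mulr_natl cardF /m; ring.
  have -> : s%:R ^+ 2 * ((M ^ s.-1)%:R ^+ 2 * S) = \sum_(f : {ffun 'I_s -> 'I_M}) \sum_(g : {ffun 'I_s -> 'I_M}) (\sum_a \sum_b LCS (v (f a)) (v (g b)))%:R.
    have -> : S = (\sum_i \sum_j LCS (v i) (v j))%N%:R.
      by rewrite natr_sum; apply: eq_bigr => i _; rewrite natr_sum.
    under [RHS]eq_bigr => f _ do rewrite -natr_sum.
    rewrite -natr_sum -!natrX -!natrM; congr (_%:R).
    (* For fixed [a] and [b], the indices [f a] and [g b] are independent and uniform, each value
       being taken by [M ^ s.-1] functions. *)
    transitivity (\sum_(a < s) \sum_(b < s) M ^ s.-1 * (M ^ s.-1 * \sum_i \sum_j LCS (v i) (v j)))%N.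
      by rewrite !sum_nat_const !card_ord; ring.
    under [RHS]eq_bigr => f _ do rewrite exchange_big /=.
    rewrite [RHS]exchange_big /=; apply: eq_bigr => a _.
    under [RHS]eq_bigr => f _ do rewrite exchange_big /=.
    rewrite [RHS]exchange_big /=; apply: eq_bigr => b _.
    under [RHS]eq_bigr => f _ do rewrite (sum_ffun_eval b (fun j => LCS (v (f a)) (v j))).
    rewrite -big_distrr /=; congr muln.
    by rewrite (sum_ffun_eval a (fun i => \sum_j LCS (v i) (v j))%N).
  rewrite -big_split /=; apply: ler_sum => f _; rewrite -big_split /=; apply: ler_sum => g _.
  by rewrite -!natrD ler_nat !PiE addnA; exact: LCS_sample.
have mle : m <= q%:R * ((1 - theta) ^+ s * N).
  rewrite /m -natr_sum sum_missing natr_sum mulr_natl -[X in _ *+ X](card_ord q) -sumr_const.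
  apply: ler_sum => a _; rewrite natrX /N natrX -exprMn.
  have cnt : #|[set i | a \notin v i]|%:R <= (1 - theta) * M%:R.
    have := freq a; have -> : [set i | a \notin v i] = ~: [set i | a \in v i]%SET.
      by apply/setP => i; rewrite !inE.
    have /(congr1 (fun n => n%:R : R)) := cardsC [set i | a \in v i]%SET.
    by rewrite natrD card_ord => <-; lra.
  by apply: lerXn2r; rewrite ?nnegrE ?ler0n // (le_trans _ cnt).
have M0' : (0 : R) < M%:R by rewrite ltr0n.
have NE : N = M%:R * (M ^ s.-1)%:R by rewrite -natrM -expnS prednK.
have K0 : (0 : R) < (M ^ s.-1)%:R by rewrite ltr0n expn_gt0 M0.
have mle' : m <= Q / 4 * N.
  apply: le_trans mle _; rewrite mulrA ler_pM2r // -QQ -mulrA ler_wpM2l //.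
have := le_trans lower upper => h.
have : Q * N ^+ 2 <= s%:R ^+ 2 * ((M ^ s.-1)%:R ^+ 2 * S) + 2 * N * (Q / 4 * N).
  apply: le_trans h _; rewrite lerD2l ler_wpM2l //; nra.
rewrite NE => h2.
rewrite -(ler_pM2r (exprn_gt0 2 K0)); nra.
Qed.

(** The blocks listed in [r] are restricted to the letters frequent among them; the lower bound on
    their LCS sum is then compared with the upper bound from shifts. *)
Lemma LT_rich (R : realType) (k L s : nat) (x0 : 'I_k) (w : seq 'I_k) (r : seq nat) :
  (forall q : nat, (0 < q)%N -> forall p : {ffun {perm 'I_q} -> R}, is_distr p ->
       Num.sqrt (q%:R : R) <= expected_LCS p) ->
  (0 < L)%N -> sorted ltn r -> {in r, forall i, (i < size w %/ L)%N} ->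
  {in r, forall i, ~~ poor L w i} -> (0 < size r)%N -> (0 < s)%N ->
  Num.sqrt (k%:R : R) * (1 - L%:R / (8 * k%:R)) ^+ s <= 4^-1 -> (L <= 8 * k)%N ->
  Num.sqrt (L%:R / 8) / 2 * (size r)%:R <= s%:R ^+ 2 * (L%:R + 4 * (LT w)%:R) :> R.
Proof.
move=> hyp L0 sr rw rich; set m := size r => m0 s0 small Lk.
have k0 : (0 < k)%N by case: (x0) => a; lia.
pose v (i : 'I_m) := block L w (nth 0 r i).
pose cnt a := #|[set i | a \in v i]|%SET.
pose pop := [set a : 'I_k | m * L <= 8 * k * cnt a]%N%SET.
(* Rich blocks give at least [m * L / 4] incidences of letters and blocks. The infrequent letters
   account for at most [m * L / 8], and each frequent one for at most [m]. *)
have Lq : (L <= 8 * #|pop|)%N.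
  have sumcnt : (\sum_a cnt a = \sum_i size (undup (v i)))%N.
    under eq_bigr => a _ do rewrite /cnt -sum1_card big_mkcond /=.
    rewrite exchange_big; apply: eq_bigr => i _ /=.
    rewrite -(card_uniqP (undup_uniq _)) -sum1_card [RHS]big_mkcond /=; apply: eq_bigr => a _.
    by rewrite inE mem_undup.
  have lo : (m * L <= 4 * \sum_a cnt a)%N.
    rewrite sumcnt big_distrr -[m in (m * L)%N]card_ord -sum_nat_const; apply: leq_sum => i _.
    by have := rich (nth 0 r i); rewrite mem_nth // /poor -leqNgt; apply.
  have hi : (8 * k * (\sum_a cnt a) <= 8 * k * (#|pop| * m) + k * (m * L))%N.
    rewrite (bigID (mem pop)) /= mulnDr leq_add //.
      rewrite leq_mul2l; apply/orP; right; rewrite -sum_nat_const; apply: leq_sum => a _.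
      by apply: leq_trans (max_card _) _; rewrite card_ord.
    rewrite big_distrr /= -[X in (_ <= X * _)%N](card_ord k) -sum_nat_const [leqRHS](bigID (mem pop)) /=.
    apply: leq_trans (leq_addl _ _); apply: leq_sum => a; rewrite inE -ltnNge; exact: ltnW.
  have : (m * k * L <= m * k * (8 * #|pop|))%N by nia.
  by rewrite leq_pmul2l // muln_gt0 m0.
have q0 : (0 < #|pop|)%N by lia.
(* Renumber the frequent letters by ['I_#|pop|] and drop the others, so that the hypothesis applies
   with [q = #|pop|]. *)
pose g a : option 'I_#|pop| := [pick j | enum_val j == a].
have gP a : oapp enum_val a (g a) = a by rewrite /g; case: pickP => //= j /eqP.
have gE j : g (enum_val j) = Some j.
  rewrite /g; case: pickP => [j' /eqP/enum_val_inj->//|/(_ j)]; by rewrite eqxx.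
pose v' i := pmap g (v i).
have v'v i : subseq (map enum_val (v' i)) (v i) by rewrite pmap_filter // filter_subseq.
have le_q : (#|pop| <= k)%N by apply: leq_trans (max_card _) _; rewrite card_ord.
have k0R : (0 : R) < k%:R by rewrite ltr0n.
have theta1 : 0 <= 1 - L%:R / (8 * k%:R) :> R.
  by rewrite subr_ge0 ler_pdivrMr ?mulr_gt0 // mul1r -natrM ler_nat.
have lower := @sum_LCS_ge R #|pop| s m v' (L%:R / (8 * k%:R)) (hyp _ q0) s0 m0.
have {}lower : Num.sqrt (#|pop|%:R : R) / 2 * m%:R ^+ 2 <= s%:R ^+ 2 * \sum_i \sum_j (LCS (v' i) (v' j))%:R.
  apply: lower.
    move=> j; have : enum_val j \in pop by exact: enum_valP.
    rewrite inE -(ler_nat R) !natrM => popj.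
    have -> : #|[set i | j \in v' i]%SET| = cnt (enum_val j).
      apply: eq_card => i; rewrite !inE mem_pmap -gE.
      apply/mapP/idP => [[a ai E]|ji]; last by exists (enum_val j).
      by have := gP a; rewrite -E gE /= => ->.
    by rewrite mulrAC ler_pdivrMr ?mulr_gt0 // mulrC; lra.
  apply: le_trans small; apply: ler_wpM2r; first exact: exprn_ge0.
  by rewrite ler_sqrt ?ltr0n // ler_nat.
have upper : \sum_i \sum_j (LCS (v' i) (v' j))%:R <= m%:R * (L%:R + 4 * (LT w)%:R) :> R.
  rewrite -natrM -natrD -natrM; under eq_bigr => i _ do rewrite -natr_sum.
  rewrite -natr_sum ler_nat; apply: leq_trans (sum_LCS_le x0 L0 sr rw).
  apply: leq_sum => i _; apply: leq_sum => j _.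
  by apply: leq_trans (LCS_map enum_val _ _) _; exact: LCS_sub.
have m0R : (0 : R) < m%:R by rewrite ltr0n.
have sq : Num.sqrt (L%:R / 8) <= Num.sqrt (#|pop|%:R : R).
  by rewrite ler_sqrt ?ltr0n // ler_pdivrMr // mulrC -natrM ler_nat.
have s2 : (0 : R) <= s%:R ^+ 2 by exact: exprn_ge0.
rewrite -(ler_pM2r m0R).
have : s%:R ^+ 2 * \sum_i \sum_j (LCS (v' i) (v' j))%:R <= s%:R ^+ 2 * (m%:R * (L%:R + 4 * (LT w)%:R)) :> R.
  exact: ler_wpM2l.
have : Num.sqrt (L%:R / 8) * m%:R ^+ 2 <= Num.sqrt (#|pop|%:R : R) * m%:R ^+ 2.
  by apply: ler_wpM2r => //; exact: exprn_ge0.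
nra.
Qed.

(** * Choice of the block length *)

(** Here [x ^+ 19] stands for [k] and [y ^+ 19] for [ln k]. Cubing works because
    [(x ^+ 12 * y ^+ 8) ^+ 3] is the square of [x ^+ 18 * y ^+ 12]; it remains that
    [8 * 140 ^ 2 / 100 ^ 3] is below [1 / 6]. The factor 2 allows for only half of the blocks being
    poor. *)
Lemma poor_rate (R : realType) (x y L c : R) : 0 < x -> 0 < y -> 0 <= L -> 0 <= c ->
  L <= 140 * (x ^+ 18 * y ^+ 12) -> L <= 6 * c ^+ 3 ->
  100^-1 / (x ^+ 12 * y ^+ 8) * (2 * L) <= c.
Proof.
move=> x0 y0 L0 c0 LE Lc; set E := x ^+ 18 * y ^+ 12 in LE.
have E0 : 0 < E by rewrite mulr_gt0 ?exprn_gt0.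
set d := x ^+ 12 * y ^+ 8.
have d0 : 0 < d by rewrite mulr_gt0 ?exprn_gt0.
have dE : d ^+ 3 = E ^+ 2 by rewrite /d /E; ring.
have L2 : L ^+ 2 <= 140 * 140 * E ^+ 2.
  by rewrite (_ : 140 * 140 * _ = (140 * E) ^+ 2); [apply: lerXn2r; rewrite ?nnegrE //; lra | ring].
have lhs0 : 0 <= 100^-1 / d * (2 * L) by rewrite !mulr_ge0 ?invr_ge0 // ltW.
rewrite -(ler_pXn2r (n := 3)) ?nnegrE //.
have -> : (100^-1 / d * (2 * L)) ^+ 3 = 8 / (100 * 100 * 100) * (L ^+ 2 / E ^+ 2) * L.
  by rewrite -dE; field; rewrite gt_eqF.
have : L ^+ 2 / E ^+ 2 <= 140 * 140 by rewrite ler_pdivrMr ?exprn_gt0.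
move=> h; have : L ^+ 2 / E ^+ 2 * L <= 140 * 140 * L by rewrite ler_wpM2r.
lra.
Qed.

(** After inserting the bound on [s] and squaring, the claim compares [y ^+ 24] with [x ^+ 2], which
    [L <= 4 * x ^+ 19] controls. The factor 8 is 2 for half of the blocks being rich times the 4 in
    front of [LT w]. *)
Lemma rich_rate (R : realType) (x y L s : R) : 0 < x -> 0 < y -> 0 < s ->
  139 * (x ^+ 18 * y ^+ 12) <= L -> L <= 4 * x ^+ 19 -> s <= 16 * (x ^+ 19 * y ^+ 19) / L ->
  100^-1 / (x ^+ 12 * y ^+ 8) * (8 * L) <= Num.sqrt (L / 8) / (2 * s ^+ 2).
Proof.
move=> x0 y0 s0 LE Lk sL.
have X n : 0 < x ^+ n by exact: exprn_gt0.
have Y n : 0 < y ^+ n by exact: exprn_gt0.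
have L0 : 0 < L by apply: lt_le_trans LE; rewrite !mulr_gt0.
(* The two bounds on [L] give [139 * y ^+ 12 <= 4 * x], and [4 * 34 <= 139]. *)
have xy : 34 * y ^+ 12 <= x.
  rewrite -(ler_pM2l (X 18%N)).
  have : 139 * (x ^+ 18 * y ^+ 12) <= 4 * (x ^+ 18 * x).
    by rewrite -exprSr; exact: le_trans LE Lk.
  have := mulr_gt0 (X 18%N) (Y 12%N); lra.
have xy2 : 1156 * y ^+ 24 <= x ^+ 2.
  rewrite (_ : 1156 * _ = (34 * y ^+ 12) ^+ 2); last by ring.
  by apply: lerXn2r; rewrite ?nnegrE // ?mulr_ge0 // ltW.
have s2 : s ^+ 2 <= (16 * (x ^+ 19 * y ^+ 19) / L) ^+ 2.
  by apply: lerXn2r; rewrite ?nnegrE //; [exact: ltW | exact: le_trans (ltW s0) sL].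
rewrite ler_pdivlMr ?mulr_gt0 ?exprn_gt0 //.
set A := 100^-1 / (x ^+ 12 * y ^+ 8) * (8 * L).
have A0 : 0 < A by rewrite !mulr_gt0 ?invr_gt0 ?mulr_gt0.
apply: (@le_trans _ _ (A * (2 * (16 * (x ^+ 19 * y ^+ 19) / L) ^+ 2))).
  by rewrite ler_pM2l // ler_pM2l.
have -> : A * (2 * (16 * (x ^+ 19 * y ^+ 19) / L) ^+ 2) = 64 * 64 / 100 * (x ^+ 26 * y ^+ 30) / L.
  by rewrite /A; field; rewrite ?gt_eqF.
have B0 : 0 < 64 * 64 / 100 * (x ^+ 26 * y ^+ 30) / L.
  by rewrite divr_gt0 ?mulr_gt0 ?invr_gt0 //.
rewrite -(gtr0_norm B0) -sqrtr_sqr ler_sqrt; last by rewrite divr_ge0 // ltW.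
rewrite [leLHS]exprMn exprVn ler_pdivrMr ?exprn_gt0 //.
have -> : L / 8 * L ^+ 2 = L ^+ 3 / 8 by ring.
rewrite ler_pdivlMr; last by lra.
have : (139 * (x ^+ 18 * y ^+ 12)) ^+ 3 <= L ^+ 3.
  by apply: lerXn2r; rewrite ?nnegrE ?mulr_ge0 // ltW.
apply: le_trans.
have -> : (139 * (x ^+ 18 * y ^+ 12)) ^+ 3 = (139 * 139 * 139) * (x ^+ 52 * y ^+ 36) * x ^+ 2 by ring.
have -> : (64 * 64 / 100 * (x ^+ 26 * y ^+ 30)) ^+ 2 * 8 = ((64 * 64 * (64 * 64)) * 8 / (100 * 100)) * (x ^+ 52 * y ^+ 36) * y ^+ 24.
  by field.
have P0 : 0 < x ^+ 52 * y ^+ 36 by rewrite mulr_gt0.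
have : (x ^+ 52 * y ^+ 36) * (1156 * y ^+ 24) <= (x ^+ 52 * y ^+ 36) * x ^+ 2 by rewrite ler_pM2l.
have := mulr_gt0 P0 (Y 24%N).
move: (x ^+ 52 * y ^+ 36) => P; rewrite -!(mulrA _ P) (mulrCA P 1156).
by move: (P * y ^+ 24) (P * x ^+ 2) => a b; lra.
Qed.

(** From [ln (1 / k) <= 1 / k - 1 <= - 1 / 2]. *)
Lemma half_le_ln (R : realType) (k : nat) : (2 <= k)%N -> 2^-1 <= ln (k%:R : R).
Proof.
move=> k2; have kR : (2 : R) <= k%:R by rewrite ler_nat.
have k0 : (0 : R) < k%:R by lra.
have : (k%:R : R)^-1 <= 2^-1 by rewrite lef_pV2 ?posrE //; lra.
have : ln ((k%:R)^-1 : R) <= (k%:R)^-1 - 1.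
  have := @le_ln1Dx R ((k%:R)^-1 - 1); rewrite addrCA subrr addr0; apply.
  by have : 0 < (k%:R : R)^-1 by [rewrite invr_gt0]; lra.
by rewrite lnV ?posrE //; lra.
Qed.

(** The power is at most [expR (- theta * s) <= 1 / k], and [1 / sqrt k <= 1 / 4]. *)
Lemma sqrt_pow_small (R : realType) (k s : nat) (theta : R) : (16 <= k)%N ->
  ln k%:R <= theta * s%:R -> theta <= 1 -> Num.sqrt (k%:R : R) * (1 - theta) ^+ s <= 4^-1.
Proof.
move=> k16 lns th1; have kR : (16 : R) <= k%:R by rewrite ler_nat.
have k0 : (0 : R) < k%:R by lra.
have : (1 - theta) ^+ s <= (k%:R)^-1.
  apply: (@le_trans _ _ (expR (- theta) ^+ s)).
    apply: lerXn2r; rewrite ?nnegrE ?expR_ge0 ?subr_ge0 //.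
    exact: expR_ge1Dx.
  rewrite -expRM_natl -[leRHS]lnK ?posrE ?invr_gt0 // ler_expR lnV ?posrE //.
  by rewrite mulrN lerN2 mulrC.
move=> h; have sq0 : 0 < Num.sqrt (k%:R : R) by rewrite sqrtr_gt0.
apply: (@le_trans _ _ (Num.sqrt (k%:R : R) * (k%:R)^-1)); first by rewrite ler_pM2l.
have sq4 : 4 <= Num.sqrt (k%:R : R).
  have -> : 4 = Num.sqrt (16 : R) by rewrite (_ : 16 = 4 ^+ 2) ?sqrtr_sqr ?ger0_norm //; ring.
  by rewrite ler_sqrt.
rewrite -{2}(sqr_sqrtr (ltW k0)) expr2 invfM mulrA divff ?gt_eqF // mul1r.
by rewrite lef_pV2 ?posrE.
Qed.

(** Nineteenth roots of [k] and [ln k] make all exponents integers, so the estimates become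
    polynomial. *)
Lemma bound_constE (R : realType) (k : nat) : (2 <= k)%N ->
  exists x y : R, [/\ 0 < x, 0 < y, x ^+ 19 = k%:R, y ^+ 19 = ln k%:R &
     bound_const R k = 100^-1 / (x ^+ 12 * y ^+ 8)].
Proof.
move=> k2; have k0 : (0 : R) < k%:R by rewrite ltr0n; lia.
have l0 : 0 < ln (k%:R : R) by have := half_le_ln R k2; lra.
exists (k%:R `^ (19^-1)), (ln k%:R `^ (19^-1)).
have powE (a : R) n : a `^ (19^-1) ^+ n = a `^ (n%:R / 19).
  by rewrite -powR_mulrn ?powR_ge0 // -powRrM mulrC.
split; rewrite ?powR_gt0 ?powE //.
- by rewrite divff ?powRr1 ?ltW // gt_eqF.
- by rewrite divff ?powRr1 ?ltW // gt_eqF.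
- by rewrite /bound_const !powRN invfM mulrA.
Qed.

(** Take the integer part of [140 * E]. Rounding loses at most 1, hence at most [E], since [E ^+ 19]
    is at least [2 ^ 18 / 2 ^ 12]. *)
Lemma block_length (R : realType) (k : nat) (x y : R) : (2 <= k)%N -> 0 < x -> 0 < y ->
  x ^+ 19 = k%:R -> y ^+ 19 = ln k%:R ->
  exists2 L : nat, (139 <= L)%N &
    139 * (x ^+ 18 * y ^+ 12) <= L%:R /\ L%:R <= 140 * (x ^+ 18 * y ^+ 12).
Proof.
move=> k2 x0 y0 xk yl; set E := x ^+ 18 * y ^+ 12.
have E0 : 0 < E by rewrite mulr_gt0 ?exprn_gt0.
have E1 : 1 <= E.
  rewrite -(ler_pXn2r (n := 19)) ?nnegrE ?(ltW E0) // expr1n.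
  have -> : E ^+ 19 = (x ^+ 19) ^+ 18 * (y ^+ 19) ^+ 12 by rewrite /E; ring.
  rewrite xk yl; apply: (@le_trans _ _ (2 ^+ 18 * 2^-1 ^+ 12)).
    by rewrite (_ : 2 ^+ 18 * 2^-1 ^+ 12 = 2 ^+ 6) ?exprn_ege1 ?ler1n //; field.
  have l2 := half_le_ln R k2.
  apply: ler_pM; rewrite ?exprn_ge0 ?invr_ge0 //.
    by apply: lerXn2r; rewrite ?nnegrE ?ler0n // ler_nat.
  by apply: lerXn2r; rewrite ?nnegrE //; lra.
have E140 : 0 <= 140 * E by lra.
have /andP[lo hi] := truncn_itv E140.
exists (Num.truncn (140 * E)).
  by rewrite -ltnS -(ltr_nat R); lra.
by split=> //; move: hi; rewrite -[(Num.truncn _).+1%:R]natr1; lra.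
Qed.

(** * Combining the poor and the rich case *)

Lemma LT_lower_bound (R : realType) (k : nat) :
  (forall q : nat, (0 < q)%N -> forall p : {ffun {perm 'I_q} -> R}, is_distr p ->
       Num.sqrt (q%:R : R) <= expected_LCS p) ->
  (2 <= k)%N ->
  exists C : R, forall w : seq 'I_k, bound_const R k * (size w)%:R - C <= (LT w)%:R.
Proof.
move=> hyp k2; have [x [y [x0 y0 xk yl ->]]] := bound_constE R k2.
have [L L139 [LlE LuE]] := block_length k2 x0 y0 xk yl.
have L0 : (0 < L)%N by lia.
have L0R : (0 : R) < L%:R by rewrite ltr0n.
have k0R : (0 : R) < k%:R by rewrite ltr0n; lia.
have l2 := half_le_ln R k2.
set D := 100^-1 / _.
have D0 : 0 < D by rewrite mulr_gt0 ?invr_gt0 ?mulr_gt0 ?exprn_gt0.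
have exc : exists c, (L <= 6 * c ^ 3)%N.
  exists L; rewrite !expnS expn0 muln1; have : (L * 1 <= L * (L * L))%N by rewrite leq_mul2l muln_gt0 L0 orbT.
  lia.
have [c Lc cmin] := ex_minnP exc.
have poorD : D * (2 * L%:R) <= c%:R.
  by apply: poor_rate; rewrite ?ler0n // -natrX -natrM ler_nat.
(* With [theta = L / (8 * k)] this is the number of draws needed for [ln k <= theta * s]. *)
pose s := (Num.truncn (8 * k%:R * ln (k%:R : R) / L%:R)).+1.
pose lam : R := Num.sqrt (L%:R / 8) / (2 * s%:R ^+ 2).
have lam0 : 0 <= lam by rewrite divr_ge0 ?sqrtr_ge0 ?mulr_ge0 ?exprn_ge0.
(* The constant absorbs the incomplete last block, in either case, and the diagonal term [L] of the
   rich case. *)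
exists (c%:R + L%:R + lam) => w.
have x1 : 'I_k by exact: (Ordinal (ltnW k2)).
set M := (size w %/ L)%N; set P := count (poor L w) (iota 0 M).
pose r := [seq i <- iota 0 M | ~~ poor L w i].
have PrM : (P + size r)%N = M by rewrite size_filter count_predC size_iota.
have szw : D * (size w)%:R <= D * (L%:R * (M%:R + 1)).
  rewrite ler_pM2l // natr1 -natrM ler_nat {1}(divn_eq (size w) L) mulnS mulnC addnC.
  by rewrite leq_add2r ltnW // ltn_mod.
have cR : (0 : R) <= c%:R by exact: ler0n.
have [pM|] := leqP M (2 * P).
  have : (P * c)%:R <= (LT w)%:R :> R.
    by rewrite ler_nat; apply: LT_poor.
  have : M%:R <= 2 * P%:R :> R by rewrite -natrM ler_nat.
  have : D * (2 * L%:R) * (M%:R + 1) <= c%:R * (M%:R + 1) by rewrite ler_wpM2r // addr_ge0.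
  rewrite natrM => h1 h2 h3.
  have : c%:R * M%:R <= c%:R * (2 * P%:R) :> R by rewrite ler_wpM2l.
  move: szw; rewrite !mulrA; nra.
have half a b m : (a + b = m -> 2 * a < m -> (0 < b) && (m <= 2 * b))%N by clear; lia.
move=> /(half _ _ _ PrM)/andP[m0 m2].
have rP i : i \in r -> (i < M)%N /\ ~~ poor L w i.
  by rewrite mem_filter mem_iota add0n => /andP[np /andP[_ iM]].
(* Some rich block exists, and its at least [L / 4] distinct letters are among [k]. *)
have L4k : (L <= 4 * k)%N.
  have [_] := rP _ (mem_nth 0%N m0); rewrite -leqNgt => h; apply: leq_trans h _.
  rewrite leq_mul2l -[k in (_ <= k)%N]card_ord; apply/orP; right.
  by rewrite -(card_uniqP (undup_uniq _)); exact: max_card.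
have L4kR : L%:R <= 4 * k%:R :> R by rewrite -natrM ler_nat.
set t : R := 8 * k%:R * ln (k%:R : R) / L%:R.
(* Hence rounding [t] up to [s] at most doubles it. *)
have t1 : 1 <= t.
  rewrite ler_pdivlMr // mul1r.
  have : k%:R * 2^-1 <= k%:R * ln (k%:R : R) by rewrite ler_pM2l.
  lra.
have /andP[ts st] := truncn_itv (le_trans ler01 t1).
have {}st : t <= s%:R by exact: ltW.
have {}ts : s%:R <= 2 * t by rewrite /s -/t -[(Num.truncn _).+1%:R]natr1; lra.
have richD : D * (8 * L%:R) <= lam.
  apply: rich_rate => //; first by rewrite xk.
  apply: le_trans ts _; rewrite xk yl [leRHS](_ : _ = 2 * t) // /t; field.
  by rewrite gt_eqF.
have small : Num.sqrt (k%:R : R) * (1 - L%:R / (8 * k%:R)) ^+ s <= 4^-1.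
  apply: sqrt_pow_small; first by move: L139 L4k; clear; lia.
    apply: (@le_trans _ _ (L%:R / (8 * k%:R) * t)).
      by rewrite /t le_eqVlt; apply/orP; left; apply/eqP; field; rewrite !gt_eqF.
    by rewrite ler_wpM2l // divr_ge0 ?mulr_ge0.
  by rewrite ler_pdivrMr ?mulr_gt0 // mul1r; lra.
have sr : sorted ltn r by apply: sorted_filter; [exact: ltn_trans | exact: iota_ltn_sorted].
have L8k : (L <= 8 * k)%N by move: L4k; clear; lia.
have := LT_rich x1 hyp L0 sr (fun i ir => (rP i ir).1) (fun i ir => (rP i ir).2) m0 (isT : (0 < s)%N) small L8k.
have s2 : 0 < s%:R ^+ 2 :> R by rewrite exprn_gt0 // ltr0n.
have -> : Num.sqrt (L%:R / 8) / 2 * (size r)%:R = s%:R ^+ 2 * (lam * (size r)%:R) :> R.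
  by rewrite /lam; field; rewrite gt_eqF // ltr0n.
rewrite ler_pM2l // => lamr.
have Mr : M%:R <= 2 * (size r)%:R :> R by rewrite -natrM ler_nat.
have h1 : D * (8 * L%:R) * (M%:R + 1) <= lam * (M%:R + 1) by rewrite ler_wpM2r // addr_ge0.
have h2 : lam * M%:R <= lam * (2 * (size r)%:R) by rewrite ler_wpM2l.
clear -szw h1 h2 lamr lam0 cR L0R.
lra.
Qed.

Theorem theorem10 (R : realType) :
  (forall (k : nat), (0 < k)%N ->
     forall p : {ffun {perm 'I_k} -> R}, is_distr p ->
       Num.sqrt (k%:R : R) <= expected_LCS p) ->
  forall k : nat, (2 <= k)%N ->
    forall eps : R, 0 < eps ->
      exists N : nat, forall n : nat, (N <= n)%N ->
        bound_const R k - eps <= (LTkn k n)%:R / n%:R.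
Proof.
move=> hyp k k2 eps eps0; have [C HC] := LT_lower_bound hyp k2.
exists (Num.truncn (`|C| / eps)).+1 => n Nn.
have n0 : (0 : R) < n%:R by rewrite ltr0n; lia.
have Cn : C <= eps * n%:R.
  have /andP[_ h] := truncn_itv (divr_ge0 (normr_ge0 C) (ltW eps0)).
  have : `|C| / eps < n%:R by apply: lt_le_trans h _; rewrite ler_nat.
  by rewrite ltr_pdivrMr // mulrC => /ltW; exact: le_trans (ler_norm C).
have HCn (w : n.-tuple 'I_k) : bound_const R k * n%:R - C <= (LT w)%:R.
  by have := HC w; rewrite size_tuple.
rewrite ler_pdivlMr //.
suff : bound_const R k * n%:R - C <= (LTkn k n)%:R by lra.
rewrite /LTkn; elim/big_ind: _ => //.
(* The initial value [n] of the minimum obeys the bound too, since [LT w <= n] for any word [w] of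
   length [n]. *)
- have w := [tuple of nseq n (Ordinal (ltnW k2))].
  by apply: le_trans (HCn w) _; rewrite ler_nat -[leqRHS](size_tuple w) LT_leq_size.
- by move=> a b ha hb; rewrite /minn; case: ifP.
Qed.
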